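(* Let $n\ge 1$ be an integer, set $D=2n+1$, and let $c>0$ be the fixed constant in the definition of the truncated lattice $L_{D,Q}$. There is a constant $K>0$, depending only on $D$ and $\phi_4$ (and on the fixed constant $c$), such that for every $\delta\in(0,1)$ and every $Q\in\mathbb{N}$, $Q\geq 1$, $$Q^{-(2n+2)}\,\#\{(u,v)\in L_{D,Q}\times L_{D,Q}: |\phi_4(u,v)-Q|\le\delta\}\ \le\ K\max\{Q^{2n},\,Q^{2n+1}\delta\}.$$
   Context: Write points of $\mathbb{R}^D=\mathbb{R}^{2n}\times\mathbb{R}$ as $x=(\underline{x},\bar{x})$ with $\underline{x}\in\mathbb{R}^{2n}$, $\bar{x}\in\mathbb{R}$. Let $J=\begin{pmatrix}0&I_n\\-I_n&0\end{pmatrix}$ be the $2n\times 2n$ standard symplectic matrix. The Heisenberg group law is $x*y=(\underline{x}+\underline{y},\ \bar{x}+\bar{y}+\tfrac12\underline{x}^{\intercal}J\underline{y})$, so $y^{-1}=-y$. The Korányi norm is $\|x\|_4=(|\underline{x}|^4+16|\bar{x}|^2)^{1/4}$ ($|\cdot|$ Euclidean), and $$\phi_4(x,y)=\|x*y^{-1}\|_4=\Big(|\underline{x}-\underline{y}|^4+16\,\big|\bar{x}-\bar{y}+\tfrac12\underline{y}^{\intercal}J\underline{x}\big|^2\Big)^{1/4}.$$ For a fixed constant $c>0$, the truncated lattice is $$L_{D,Q}=\{b=(b_1,\dots,b_D)\in\mathbb{Z}^D: |b_i|\le cQ \text{ for } 1\le i\le D-1,\ |b_D|\le cQ^2\}.$$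 *)

(* Defs.v *)
From HB Require Import structures.
From mathcomp Require Import all_boot all_order all_algebra finmap zify.
From mathcomp Require Import all_classical all_reals all_analysis.

Set Implicit Arguments.
Unset Strict Implicit.
Unset Printing Implicit Defensive.

Import Order.TTheory GRing.Theory Num.Theory.

Local Open Scope classical_set_scope.
Local Open Scope ring_scope.

(* Points of A^(2n+1) are column vectors; splitting the dimension as
   (n + n) + 1 makes the decomposition x = (horiz x, vert x) a block one. *)
Definition heis (A : Type) (n : nat) := 'cV[A]_(n + n + 1).

Definition horiz (A : Type) (n : nat) (x : heis A n) : 'cV[A]_(n + n) :=
  usubmx x.

Definition vert (A : Type) (n : nat) (x : heis A n) : A := dsubmx x ord0 ord0.

Section Heisenberg.
Variables (R : realType) (n : nat).
Implicit Types x y : heis R n.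

Definition symplJ : 'M[R]_(n + n) := block_mx 0 1%:M (- 1%:M) 0.

Definition sympl (a b : 'cV[R]_(n + n)) : R := (a^T *m symplJ *m b) ord0 ord0.

Definition heis_mul x y : heis R n :=
  col_mx (horiz x + horiz y)
         (const_mx (vert x + vert y + 2^-1 * sympl (horiz x) (horiz y))).

Definition heis_inv x : heis R n := - x.

(* The library norm `|_| on matrices is the sup norm, not this one. *)
Definition eucl_norm (a : 'cV[R]_(n + n)) : R :=
  Num.sqrt (\sum_i a i ord0 ^+ 2).

Definition koranyi_norm x : R :=
  (eucl_norm (horiz x) ^+ 4 + 16 * `|vert x| ^+ 2) `^ 4^-1.

Definition phi4 x y : R := koranyi_norm (heis_mul x (heis_inv y)).

Lemma horiz_mul x y : horiz (heis_mul x y) = horiz x + horiz y.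
Proof. by rewrite /horiz col_mxKu. Qed.

Lemma vert_mul x y :
  vert (heis_mul x y) = vert x + vert y + 2^-1 * sympl (horiz x) (horiz y).
Proof. by rewrite /vert col_mxKd mxE. Qed.

Lemma horizN x : horiz (- x) = - horiz x.
Proof. by apply/matrixP => i j; rewrite !mxE. Qed.

Lemma vertN x : vert (- x) = - vert x.
Proof. by rewrite /vert !mxE. Qed.

Lemma symplC a b : sympl a b = - sympl b a.
Proof.
have JT : symplJ^T = - symplJ.
  by rewrite /symplJ tr_block_mx !trmx0 linearN /= trmx1 opp_block_mx
    !oppr0 opprK.
rewrite /sympl; transitivity ((a^T *m symplJ *m b)^T ord0 ord0).
  by rewrite [RHS]mxE.
rewrite !trmx_mul trmxK JT mulmxA.
by rewrite mulmxN mulNmx mxE.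
Qed.

Lemma symplNr a b : sympl a (- b) = - sympl a b.
Proof. by rewrite /sympl mulmxN mxE. Qed.

Lemma sympl_diag a : sympl a a = 0.
Proof.
have /eqP := symplC a a; rewrite -addr_eq0 -mulr2n mulrn_eq0 /=.
by move/eqP.
Qed.

Lemma heis_mulxV x : heis_mul x (heis_inv x) = 0.
Proof.
rewrite /heis_mul horizN vertN !subrr symplNr sympl_diag oppr0 mulr0 addr0.
have -> : const_mx 0 = 0 :> 'M[R]_1 by apply/matrixP => i j; rewrite !mxE.
exact: col_mx0.
Qed.

Lemma phi4E x y :
  phi4 x y =
  (eucl_norm (horiz x - horiz y) ^+ 4 +
   16 * `|vert x - vert y + 2^-1 * sympl (horiz y) (horiz x)| ^+ 2) `^ 4^-1.
Proof.
by rewrite /phi4 /koranyi_norm horiz_mul vert_mul horizN vertN symplNr -symplC.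
Qed.

Definition heis_int (b : heis int n) : heis R n := map_mx intr b.

Definition trunc_lattice (c : R) (Q : nat) : set (heis int n) :=
  [set b | (forall i, `|horiz b i ord0|%:~R <= c * Q%:R) /\
           `|vert b|%:~R <= c * Q%:R ^+ 2].

Definition near_pairs (c delta : R) (Q : nat) : set (heis int n * heis int n) :=
  [set p | [/\ trunc_lattice c Q p.1, trunc_lattice c Q p.2 &
    `|phi4 (heis_int p.1) (heis_int p.2) - Q%:R| <= delta]].

(* [fset_set] sends an infinite set to the empty one, so the cardinality in the
   theorem is meaningful only because these sets are finite. *)
Lemma finite_trunc_lattice c Q : finite_set (trunc_lattice c Q).
Proof.
pose m := (Num.truncn (Num.max (c * Q%:R) (c * Q%:R ^+ 2))).+1.
have bnd (z : int) :
    `|z|%:~R <= Num.max (c * Q%:R) (c * Q%:R ^+ 2) -> (absz z <= m)%N.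
  move=> zM; have := le_lt_trans zM (truncnS_gt _).
  by rewrite -abszE -pmulrn ltr_nat => /ltnW.
pose f (A : 'M['I_(m + m).+1]_(n + n + 1, 1)) : heis int n :=
  map_mx (fun i : 'I_(m + m).+1 => i%:Z - m%:Z) A.
apply: (@sub_finite_set _ _ (f @` setT)); last exact/finite_image/finite_finset.
move=> b [bh bv].
have b_le i : (absz (b i ord0) <= m)%N.
  apply: bnd; rewrite le_max; case: (split_ordP i) => k ->.
    by have := bh k; rewrite mxE => ->.
  by move: bv; rewrite /vert mxE (ord1 k) => ->; rewrite orbT.
exists (\matrix_(i, j) inord (absz (b i j + m%:Z))) => //.
apply/matrixP => i j; rewrite !mxE (ord1 j).
have := b_le i; set z := b i _ => zm.
have ge0 : 0 <= z + m%:Z by lia.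
by rewrite inordK; lia.
Qed.

Lemma finite_near_pairs c delta Q : finite_set (near_pairs c delta Q).
Proof.
have fL := finite_trunc_lattice c Q.
by apply: sub_finite_set (finite_setX fL fL) => p [].
Qed.

End Heisenberg.

(* Main.v *)
(** For a fixed v, the point u * v^-1 has an integral horizontal part a and a
vertical part m / 2 with m an integer, and |phi_4(u, v) - Q| <= delta means that
|a|^4 + 4 m^2 lies in an interval [A, B] of length L = O(Q^3 delta).  It is
therefore enough to find O(Q^(2n) (1 + Q delta)) solutions (a, m).

For a given a, put P = B - |a|^4; the number of m is at most 1 + O(L / sqrt P).
If all |a_i| are at most a small multiple of Q, then P >> Q^4 and each a
contributes O(1 + Q delta).  Otherwise some |a_i| >> Q.  Fix the other
coordinates and let X be the largest value of |a_i| that occurs: at |a_i| = X - k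
one has P >> k Q^3, and sum_(k <= 2 Q) k^(-1/2) = O(Q^(1/2)) bounds the
contribution of k >= 1 by O(Q + Q^2 delta).  For k = 0, where P may vanish, the
number of m is at most 1 + sqrt L, and sqrt(Q^3 delta) is the geometric mean of
Q and Q^2 delta. *)

Require Import Defs.
From mathcomp Require Import all_boot all_order all_algebra finmap.
From mathcomp Require Import zify ring lra.
From mathcomp Require Import all_classical all_reals all_analysis.

Import Order.TTheory GRing.Theory Num.Theory.

Local Open Scope classical_set_scope.
Local Open Scope ring_scope.

(** * Counting squares in short intervals *)

(** Subtracting the least element embeds [E] into the integers from 0 to the floor of [D]. *)
Lemma card_ord_diam (R : realType) (N : nat) (E : {pred 'I_N}) (D : R) :
  0 <= D ->
  (forall x y : 'I_N, x \in E -> y \in E -> (x <= y)%N -> y%:R - x%:R <= D) ->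
  #|E|%:R <= 1 + D.
Proof.
move=> D0 ED; case: (pickP E) => [x Ex|E0]; last first.
  by rewrite (eq_card0 E0) addr_ge0.
have [x0 Ex0 min_x0] := arg_minnP (fun y : 'I_N => (y : nat)) Ex.
have lt_trunc y : y \in E -> (y - x0 < (Num.truncn D).+1)%N.
  move=> Ey; rewrite ltnS truncn_ge_nat//.
  by rewrite natrB ?min_x0//; apply: ED => //; apply: min_x0.
pose f (y : 'I_N) : 'I_(Num.truncn D).+1 := inord (y - x0).
have f_inj : {in E &, injective f}.
  move=> y z Ey Ez /(congr1 (@nat_of_ord _)).
  rewrite !inordK ?lt_trunc// => yz; apply: val_inj => /=.
  by have := min_x0 _ Ey; have := min_x0 _ Ez; lia.
rewrite -(card_in_image f_inj) addrC.
apply: (@le_trans _ _ (Num.truncn D).+1%:R).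
  by rewrite ler_nat (leq_trans (max_card _))// card_ord.
by rewrite -natr1 lerD2r truncn_le.
Qed.

Lemma card_sqr_window (R : realType) (N : nat) (P L w : R) :
  0 < w -> w ^+ 2 <= P -> 0 <= L ->
  #|[pred m : 'I_N | P - L <= 4 * m%:R ^+ 2 <= P]|%:R <= 1 + L / w.
Proof.
move=> w0 wP L0; apply: card_ord_diam; first by rewrite divr_ge0// ltW.
move=> x y; rewrite !inE => /andP[xl _] /andP[_ yu] xy.
have {xy}: x%:R <= y%:R :> R by rewrite ler_nat.
have := ler0n R x; move: xl yu.
move: (x%:R : R) (y%:R : R) => a b Pa bP a0 ab.
rewrite ler_pdivlMr//.
(* If w <= 4 b, then w (b - a) <= 4 (b^2 - a^2) <= L. Otherwise a <= b < w / 4, and w^2 <= P forces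
   L >= 3 w^2 / 4 > w (b - a). *)
case: (leP w (4 * b)) => wb; nra.
Qed.

(** Needs no lower bound on P: for 0 <= a <= b, (b - a)^2 <= b^2 - a^2 <= L / 4. *)
Lemma card_sqr_window_sqrt (R : realType) (N : nat) (P L r : R) :
  0 <= r -> L <= r ^+ 2 ->
  #|[pred m : 'I_N | P - L <= 4 * m%:R ^+ 2 <= P]|%:R <= 1 + r.
Proof.
move=> r0 Lr; apply: card_ord_diam => //.
move=> x y; rewrite !inE => /andP[xl _] /andP[_ yu] xy.
have {xy}: x%:R <= y%:R :> R by rewrite ler_nat.
have := ler0n R x; move: xl yu.
move: (x%:R : R) (y%:R : R) => a b Pa bP a0 ab.
rewrite -(@ler_pXn2r _ 2)// ?nnegrE ?subr_ge0//.
nra.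
Qed.

(** * Auxiliary sums and cardinalities *)

Lemma sum_inv_sqrt (R : realType) (X : nat) :
  \sum_(x < X) (Num.sqrt (X - x)%:R)^-1 <= 2 * Num.sqrt X%:R :> R.
Proof.
elim: X => [|X IH]; first by rewrite big_ord0 mulr_ge0 ?sqrtr_ge0.
rewrite big_ord_recl subn0.
under eq_bigr => i _ do rewrite /= /bump add1n subSS.
apply: le_trans (lerD (lexx _) IH) _.
have := sqr_sqrtr (ler0n R X); have := sqr_sqrtr (ler0n R X.+1).
have s0 : 0 < Num.sqrt X.+1%:R :> R by rewrite sqrtr_gt0.
have := sqrtr_ge0 (X%:R : R).
rewrite -natr1; move: s0; rewrite -natr1.
move: (Num.sqrt _) (Num.sqrt _) => b a b0 a0 bE aE.
(* The sum telescopes through 1 / b <= 2 (b - a), which is (b - a)^2 >= 0 because b^2 = a^2 + 1. *)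
rewrite -lerBrDr -[leLHS]mul1r ler_pdivrMr//; nra.
Qed.

(** Averaging over all lines in direction [i]; this reduces the count in d coordinates to a count in
    one. *)
Lemma sum_ffun_line (R : realType) (d N : nat) (i : 'I_d)
    (G : {ffun 'I_d -> 'I_N.+1} -> R) (E : R) :
  (forall g : {ffun 'I_d -> 'I_N.+1},
    \sum_(x < N.+1) G [ffun j => if j == i then x else g j] <= E * N.+1%:R) ->
  \sum_g G g <= E * N.+1%:R ^+ d.
Proof.
move=> GE.
pose set (g : {ffun 'I_d -> 'I_N.+1}) x := [ffun j => if j == i then x else g j].
pose h (p : 'I_N.+1 * {ffun 'I_d -> 'I_N.+1}) := (p.2 i, set p.2 p.1).
(* Exchanging the free value x with g i turns N.+1 copies of the sum over g
   into the sum of the line sums. *)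
have hK : involutive h.
  move=> [x g]; rewrite /h /set /= ffunE eqxx; congr pair.
  by apply/ffunP => j; rewrite !ffunE; case: eqP => // ->.
have avg : N.+1%:R * \sum_g G g = \sum_g \sum_(x < N.+1) G (set g x).
  transitivity (\sum_(p : 'I_N.+1 * {ffun 'I_d -> 'I_N.+1}) G p.2).
    rewrite -(pair_big xpredT xpredT (fun _ g => G g)) /=.
    by rewrite sumr_const card_ord mulr_natl.
  rewrite [RHS]exchange_big pair_big /= (reindex_inj (inv_inj hK)) /=.
  by apply: eq_bigr.
rewrite -(@ler_pM2l _ N.+1%:R) ?ltr0n// avg.
apply: le_trans (ler_sum _ (fun g _ => GE g)) _.
by rewrite sumr_const card_ffun !card_ord -[leLHS]mulr_natr natrX (mulrC E) mulrA.
Qed.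

Lemma card_fset_set_le (T : choiceType) (F : finType) (S : set T) (f : T -> F)
    (D : {pred F}) :
  finite_set S -> (forall x, S x -> f x \in D) ->
  (forall x y, S x -> S y -> f x = f y -> x = y) ->
  (#|` fset_set S|%fset <= #|D|)%N.
Proof.
move=> fS SD inj; rewrite -(size_map f).
have /card_uniqP <- : uniq [seq f x | x <- fset_set S].
  rewrite map_inj_in_uniq ?fset_uniq// => x y.
  by rewrite !in_fset_set// !inE; apply: inj.
apply/subset_leq_card/fintype.subsetP => _ /mapP[x + ->].
by rewrite in_fset_set// inE; apply: SD.
Qed.

(** * Integer points in the shell *)

(** Here [x] is the large coordinate and [s] the sum of squares of the fixed ones. The cutoff is
    written with e^2 so that the square root of (e^2 Q)^3 is e^3 Q^(3/2). *)
Lemma planar_count (R : realType) (Q M : nat) (delta e s A B : R) :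
  (0 < Q)%N -> 0 < delta -> 0 < e -> 0 <= s ->
  A <= B -> B - A <= 16 * Q%:R ^+ 3 * delta ->
  \sum_(x < (2 * Q).+1 | e ^+ 2 * Q%:R < x%:R)
     #|[pred m : 'I_M | A <= (s + x%:R ^+ 2) ^+ 2 + 4 * m%:R ^+ 2 <= B]|%:R
  <= (5 + 64 / e ^+ 3) * (Q%:R + Q%:R ^+ 2 * delta).
Proof.
move=> Q0 d0 e0 s0 AB BA.
have Q1 : 1 <= Q%:R :> R by rewrite ler1n.
set q : R := Q%:R in Q1 BA *.
pose w x : pred 'I_M :=
  [pred m : 'I_M | A <= (s + x%:R ^+ 2) ^+ 2 + 4 * m%:R ^+ 2 <= B].
have wE x : w x =i [pred m : 'I_M |
    (B - (s + x%:R ^+ 2) ^+ 2) - (B - A) <= 4 * m%:R ^+ 2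
      <= B - (s + x%:R ^+ 2) ^+ 2].
  by move=> m; rewrite !inE; apply/idP/idP => /andP[? ?]; apply/andP; split; lra.
have q0 : 0 < q by lra.
have qqd : 0 <= q ^+ 2 * delta by rewrite mulr_ge0 ?sqr_ge0// ltW.
have qd0 : 0 <= q + q ^+ 2 * delta by lra.
have e30 : 0 <= 64 / e ^+ 3 by rewrite divr_ge0// exprn_ge0// ltW.
(* [T] holds the admissible x with a nonempty fibre; [X] below is its maximum, with witness [m0]. *)
pose T := [pred x : 'I_(2 * Q).+1 |
  (e ^+ 2 * q < x%:R) && [exists m, w x m]].
have [x0 Tx0|T0] := pickP T; last first.
  rewrite big1 ?mulr_ge0 ?addr_ge0// => x ex.
  rewrite eq_card0// => m; apply/negbTE/negP => wm.
  by have /negP := negbT (T0 x); apply; rewrite /= ex; apply/existsP; exists m.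
have [X /andP[eX /existsP[m0 wX]] maxX] :=
  arg_maxnP (fun y : 'I_(2 * Q).+1 => (y : nat)) Tx0.
have X0 : 0 < X%:R :> R by apply: le_lt_trans eX; rewrite mulr_ge0 ?sqr_ge0 ?ler0n.
have XQ : X%:R <= 2 * q :> R.
  by rewrite -natrM ler_nat -ltnS ltn_ord.
have bndX : #|w X|%:R <= 1 + 2 * (q + q ^+ 2 * delta).
  rewrite (eq_card (wE X)); apply: card_sqr_window_sqrt; first by rewrite mulr_ge0.
  apply: le_trans BA _.
  (* AM-GM for q and q ^+ 2 * delta *)
  have -> : 16 * q ^+ 3 * delta =
    (2 * (q + q ^+ 2 * delta)) ^+ 2 - (2 * (q - q ^+ 2 * delta)) ^+ 2 by ring.
  by rewrite gerBl sqr_ge0.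
pose sq := Num.sqrt q.
have sq0 : 0 < sq by rewrite sqrtr_gt0; lra.
have sqE : sq ^+ 2 = q by rewrite sqr_sqrtr; lra.
have bnd (x : 'I_(2 * Q).+1) : (x < X)%N ->
    #|w x|%:R <= 1 + 16 * q ^+ 3 * delta / (e ^+ 3 * sq ^+ 3)
                     * (Num.sqrt (X - x)%:R)^-1.
  move=> xX; have kpos : (0 < X - x)%N by rewrite subn_gt0.
  have k0 : 0 < Num.sqrt (X - x)%:R :> R by rewrite sqrtr_gt0 ltr0n.
  have kE := sqr_sqrtr (ler0n R (X - x)).
  (* v^2 = (e^2 q)^3 (X - x) is the lower bound for P at x. *)
  pose v : R := e ^+ 3 * sq ^+ 3 * Num.sqrt (X - x)%:R.
  have v0 : 0 < v by rewrite /v !mulr_gt0 ?exprn_gt0.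
  apply: (@le_trans _ _ (1 + (B - A) / v)).
    rewrite (eq_card (wE x)); apply: card_sqr_window => //; last by rewrite subr_ge0.
    have -> : v ^+ 2 = (e ^+ 2 * q) ^+ 3 * (X - x)%:R.
      by rewrite /v exprMn kE -sqE; ring.
    have /andP[_ wX'] := wX.
    have x0' : 0 <= x%:R :> R by [].
    have xXr : x%:R <= X%:R :> R by rewrite ler_nat ltnW.
    rewrite natrB ?(ltnW xX)//.
    have c0 : 0 <= e ^+ 2 * q by rewrite mulr_ge0 ?sqr_ge0//; lra.
    have le3 : (e ^+ 2 * q) ^+ 3 <= X%:R ^+ 3 by rewrite lerXn2r ?nnegrE// ltW.
    have le3' : (e ^+ 2 * q) ^+ 3 * (X%:R - x%:R) <= X%:R ^+ 3 * (X%:R - x%:R).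
      by rewrite ler_wpM2r// subr_ge0.
    apply: le_trans le3' _.
    have m0s : 0 <= (m0%:R : R) ^+ 2 by rewrite sqr_ge0.
    (* The witness [m0] gives (s + X^2)^2 <= B, so P at x is at least this difference of squares. *)
    apply: (@le_trans _ _ ((s + X%:R ^+ 2) ^+ 2 - (s + x%:R ^+ 2) ^+ 2)); last by lra.
    rewrite -subr_ge0.
    have -> : (s + X%:R ^+ 2) ^+ 2 - (s + x%:R ^+ 2) ^+ 2
        - X%:R ^+ 3 * (X%:R - x%:R)
      = (X%:R - x%:R) * (X%:R * (X%:R * x%:R + x%:R ^+ 2 + 2 * s)
                         + x%:R * (x%:R ^+ 2 + 2 * s)) :> R.
      by ring.
    by rewrite mulr_ge0 ?subr_ge0// !(mulr_ge0, addr_ge0).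
  rewrite lerD2l /v [in leLHS]invfM mulrA.
  rewrite ler_wpM2r ?invr_ge0 ?(ltW k0)// ler_wpM2r//.
  by rewrite invr_ge0 mulr_ge0 ?exprn_ge0 ?ltW.
(* The sum splits into x < X, x = X and x > X; the last part vanishes by maximality of X. *)
rewrite (bigID (fun x : 'I__ => (x < X)%N)) /= addrC (bigD1 X) /= ?eX ?ltnn//.
rewrite [Y in _ + Y + _]big1 ?addr0; last first.
  move=> x /andP[/andP[ex Xx] xX]; rewrite eq_card0// => m.
  apply/negbTE/negP => wm; have /maxX : T x by rewrite /= ex; apply/existsP; exists m.
  by move=> /= x_le; case/eqP: xX; apply/val_inj/eqP; rewrite eqn_leq x_le leqNgt.
have XN : (X <= (2 * Q).+1)%N by exact: ltnW.
have sumX : \sum_(x < (2 * Q).+1 | (e ^+ 2 * q < x%:R) && (x < X)%N) #|w x|%:R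
    <= X%:R + 16 * q ^+ 3 * delta / (e ^+ 3 * sq ^+ 3) * (2 * Num.sqrt X%:R).
  set a := (_ / _).
  have a0 : 0 <= a.
    by rewrite /a divr_ge0// !mulr_ge0 ?exprn_ge0 ?(ltW e0) ?(ltW sq0)
      ?(ltW q0) ?(ltW d0).
  apply: (@le_trans _ _ (\sum_(x < (2 * Q).+1 | (x < X)%N)
      (1 + a * (Num.sqrt (X - x)%:R)^-1))).
    rewrite big_mkcondl /=; apply: ler_sum => x xX.
    case: ifP => _; first exact: bnd.
    by rewrite addr_ge0// (mulr_ge0 a0)// invr_ge0 sqrtr_ge0.
  rewrite -(big_ord_widen _ (fun x => 1 + a * (Num.sqrt (X - x)%:R)^-1) XN).
  rewrite big_split /= sumr_const card_ord lerD2l -mulr_sumr.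
  by rewrite ler_wpM2l// sum_inv_sqrt.
apply: le_trans (lerD bndX sumX) _.
have sX : Num.sqrt X%:R <= 2 * sq.
  rewrite -(@ler_pXn2r _ 2)// ?nnegrE ?sqrtr_ge0 ?mulr_ge0 ?ltW//.
  by rewrite sqr_sqrtr// exprMn sqE; lra.
have last : 16 * q ^+ 3 * delta / (e ^+ 3 * sq ^+ 3) * (2 * Num.sqrt X%:R)
    <= 64 / e ^+ 3 * (q ^+ 2 * delta).
  have -> : 64 / e ^+ 3 * (q ^+ 2 * delta) =
      16 * q ^+ 3 * delta / (e ^+ 3 * sq ^+ 3) * (2 * (2 * sq)).
    rewrite -sqE; field; rewrite !gt_eqF//.
  apply: ler_wpM2l; last exact: ler_wpM2l.
  by rewrite divr_ge0// !mulr_ge0 ?exprn_ge0 ?(ltW e0) ?(ltW sq0) ?(ltW q0) ?(ltW d0).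
(* The coefficient 5 of q collects 1 <= q, 2 q from x = X, and X <= 2 q; the term 64 / e^3 q is
   slack giving both terms a common factor. *)
have : 0 <= 64 / e ^+ 3 * q by rewrite mulr_ge0//; lra.
lra.
Qed.

Lemma koranyi_shell_count (R : realType) (d Q M : nat) (delta : R) :
  (0 < Q)%N -> 0 < delta -> delta < 1 ->
  #|[pred p : {ffun 'I_d -> 'I_(2 * Q).+1} * 'I_M |
      (Q%:R - delta) ^+ 4 <= (\sum_i (p.1 i)%:R ^+ 2) ^+ 2 + 4 * p.2%:R ^+ 2
        <= (Q%:R + delta) ^+ 4]|%:R
  <= (32 + d%:R * (5 + 64 * d.+1%:R ^+ 3)) * (1 + Q%:R * delta)
     * (2 * Q).+1%:R ^+ d.
Proof.
move=> Q0 d0 d1; set N := (2 * Q).+1.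
have Q1 : 1 <= Q%:R :> R by rewrite ler1n.
set q : R := Q%:R in Q1 *.
set A := (q - delta) ^+ 4; set B := (q + delta) ^+ 4.
have q0 : 0 < q by lra.
have dE : B - A = 8 * q ^+ 3 * delta + 8 * q * delta ^+ 3 by rewrite /A /B; ring.
have dq : delta ^+ 3 <= q ^+ 2 * delta.
  by rewrite exprSr ler_wpM2r ?(ltW d0)// lerXn2r// ?nnegrE; lra.
have AB : A <= B.
  by rewrite -subr_ge0 dE addr_ge0// !mulr_ge0 ?exprn_ge0 ?(ltW q0) ?(ltW d0).
have BA : B - A <= 16 * q ^+ 3 * delta.
  have := ler_wpM2l (ltW q0) dq; rewrite dE.
  have -> : q * (q ^+ 2 * delta) = q ^+ 3 * delta by ring.
  lra.
(* This choice gives d e^4 <= 1 / 2, since 2 d <= (d + 1)^2 <= (d + 1)^4. *)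
pose e : R := d.+1%:R^-1.
have e0 : 0 < e by rewrite invr_gt0.
pose S (g : {ffun 'I_d -> 'I_N}) : R := \sum_i (g i)%:R ^+ 2.
pose F (g : {ffun 'I_d -> 'I_N}) : R :=
  #|[pred m : 'I_M | A <= S g ^+ 2 + 4 * m%:R ^+ 2 <= B]|%:R.
have -> : #|[pred p : {ffun 'I_d -> 'I_N} * 'I_M |
    A <= (\sum_i (p.1 i)%:R ^+ 2) ^+ 2 + 4 * p.2%:R ^+ 2 <= B]|%:R = \sum_g F g.
  rewrite /F -natr_sum -sum1_card.
  under [in RHS]eq_bigr => g _ do rewrite -sum1_card.
  by rewrite pair_big_dep.
have qd0 : 0 <= 1 + q * delta by rewrite addr_ge0// mulr_ge0 ?ltW.
have flat (g : {ffun 'I_d -> 'I_N}) :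
    (forall i, (g i)%:R <= e ^+ 2 * q) -> F g <= 32 * (1 + q * delta).
  move=> g_small.
  have S0 : 0 <= S g by apply: sumr_ge0 => i _; rewrite sqr_ge0.
  have Sle : S g <= 2^-1 * q ^+ 2.
    apply: (@le_trans _ _ (\sum_(i < d) (e ^+ 2 * q) ^+ 2)).
      apply: ler_sum => i _; rewrite lerXn2r ?g_small// nnegrE ?ler0n//.
      by rewrite mulr_ge0 ?sqr_ge0// ltW.
    rewrite sumr_const card_ord -[leLHS]mulr_natl.
    have -> : d%:R * (e ^+ 2 * q) ^+ 2 = d%:R * e ^+ 4 * q ^+ 2 by ring.
    rewrite ler_wpM2r ?sqr_ge0//.
    rewrite /e exprVn ler_pdivrMr ?exprn_gt0// ler_pdivlMl// -natrX -natrM ler_nat.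
    rewrite (expnD _ 2 2); have : (2 * d <= d.+1 ^ 2)%N by nia.
    move=> /leq_trans; apply; rewrite leq_pmulr// expn_gt0//.
  have -> : F g = #|[pred m : 'I_M |
     (B - S g ^+ 2) - (B - A) <= 4 * m%:R ^+ 2 <= B - S g ^+ 2]|%:R.
    congr (_%:R); apply: eq_card => m; rewrite !inE.
    by apply/idP/idP => /andP[? ?]; apply/andP; split; lra.
  apply: (@le_trans _ _ (1 + (B - A) / (2^-1 * q ^+ 2))).
    have q20 : 0 < q ^+ 2 by rewrite exprn_gt0.
    apply: card_sqr_window; [lra| |by rewrite subr_ge0].
    have : q ^+ 4 <= B by rewrite lerXn2r// ?nnegrE; lra.
    have -> : q ^+ 4 = (q ^+ 2) ^+ 2 by ring.
    (* P = B - S^2 >= q^4 - q^4 / 4, which exceeds (q^2 / 2)^2. *)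
    move: Sle q20 S0; move: (S g) (q ^+ 2) => a b ab b0 a0; nra.
  suff : (B - A) / (2^-1 * q ^+ 2) <= 32 * q * delta by lra.
  rewrite ler_pdivrMr ?mulr_gt0 ?exprn_gt0// (le_trans BA)//.
  by rewrite le_eqVlt; apply/orP; left; apply/eqP; field.
(* [F g] is charged to every coordinate above the cutoff; if there is none, [flat] applies. *)
pose G i (g : {ffun 'I_d -> 'I_N}) : R := if e ^+ 2 * q < (g i)%:R then F g else 0.
have F0 (g : {ffun 'I_d -> 'I_N}) : 0 <= F g by rewrite ler0n.
have FG (g : {ffun 'I_d -> 'I_N}) : F g <= 32 * (1 + q * delta) + \sum_i G i g.
  have G0 i : 0 <= G i g by rewrite /G; case: ifP.
  have [/existsP[i gi]|/existsPn small] := boolP [exists i, e ^+ 2 * q < (g i)%:R].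
    rewrite (bigD1 i)//= {1}/G gi addrCA lerDl addr_ge0 ?mulr_ge0//.
    by apply: sumr_ge0 => j _.
  apply: le_trans (flat g _) _ => [i|]; first by rewrite leNgt.
  by rewrite lerDl sumr_ge0.
have lineG i : \sum_g G i g <= (5 + 64 * d.+1%:R ^+ 3) * (1 + q * delta) * N%:R ^+ d.
  apply: (sum_ffun_line _ _ _ i) => g.
  pose s : R := \sum_(j | j != i) (g j)%:R ^+ 2.
  have sE (x : 'I_N) : S [ffun j => if j == i then x else g j] = s + x%:R ^+ 2.
    rewrite /S (bigD1 i)//= ffunE eqxx addrC; congr (_ + _).
    by apply: eq_bigr => j /negbTE ji; rewrite ffunE ji.
  under eq_bigr => x _ do rewrite /G /F sE ffunE eqxx.
  rewrite -big_mkcond /=.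
  have s0 : 0 <= s by apply: sumr_ge0 => j _; rewrite sqr_ge0.
  apply: le_trans (planar_count _ _ _ _ _ _ _ _ Q0 d0 e0 s0 AB BA) _.
  have -> : 64 / e ^+ 3 = 64 * d.+1%:R ^+ 3 by rewrite /e exprVn invrK.
  (* The factor q split off here is absorbed by the line length N = 2 Q + 1. *)
  have -> : Q%:R + Q%:R ^+ 2 * delta = (1 + q * delta) * q by rewrite -/q; ring.
  rewrite [leLHS]mulrA ler_wpM2l//.
    by rewrite mulr_ge0// addr_ge0// mulr_ge0// exprn_ge0.
  by rewrite ler_nat /N; lia.
apply: le_trans (ler_sum _ (fun g _ => FG g)) _.
rewrite big_split /= sumr_const card_ffun !card_ord exchange_big /=.
apply: le_trans (lerD (lexx _) (ler_sum _ (fun i _ => lineG i))) _.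
rewrite sumr_const card_ord -[_ *+ (N ^ d)]mulr_natr natrX -[_ *+ d]mulr_natl.
by rewrite le_eqVlt; apply/orP; left; apply/eqP; ring.
Qed.

(** * From lattice pairs to shell points *)

Lemma heis_ext (A : Type) (n : nat) (x y : heis A n) :
  horiz x = horiz y -> vert x = vert y -> x = y.
Proof.
move=> hxy vxy; rewrite -[x]vsubmxK -[y]vsubmxK; congr col_mx => //.
by apply/matrixP => i j; rewrite !ord1.
Qed.

Definition int_symplJ (n : nat) : 'M[int]_(n + n) :=
  block_mx 0 1%:M (- 1%:M) 0.

(* Twice the vertical coordinate of u * v^-1, which is an integer. *)
Definition vert_diff2 {n : nat} (u v : heis int n) : int :=
  2 * (vert u - vert v) + ((horiz v)^T *m int_symplJ n *m horiz u) ord0 ord0.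

(** The fourth power removes the root, and a vertical coordinate t / 2 contributes 16 (t / 2)^2 = 4
    t^2. *)
Lemma phi4_int (R : realType) (n : nat) (u v : heis int n) :
  phi4 (heis_int R u) (heis_int R v) ^+ 4 =
  (\sum_i (absz ((horiz u - horiz v)%R i ord0))%:R ^+ 2) ^+ 2
    + 4 * (absz (vert_diff2 u v))%:R ^+ 2 :> R.
Proof.
have absE (z : int) : (absz z)%:R ^+ 2 = z%:~R ^+ 2 :> R.
  by rewrite pmulrn abszE intr_norm real_normK// num_real.
have hE (x : heis int n) : horiz (heis_int R x) = map_mx intr (horiz x).
  by rewrite /horiz /heis_int map_usubmx.
have vE (x : heis int n) : vert (heis_int R x) = (vert x)%:~R.
  by rewrite /vert !mxE.
have sE : sympl (horiz (heis_int R v)) (horiz (heis_int R u)) =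
    (((horiz v)^T *m int_symplJ n *m horiz u) ord0 ord0)%:~R.
  have JE : symplJ R n = map_mx intr (int_symplJ n).
    by rewrite /symplJ /int_symplJ map_block_mx !map_mx0 map_mxN map_mx1.
  by rewrite /sympl JE !hE map_trmx -!map_mxM mxE.
rewrite phi4E -powR_mulrn ?powR_ge0// -powRrM mulVf// powRr1; last first.
  by rewrite addr_ge0 ?mulr_ge0 ?exprn_ge0 ?sqrtr_ge0.
rewrite real_normK ?num_real// sE !hE !vE /eucl_norm.
rewrite (exprM _ 2 2) sqr_sqrtr ?sumr_ge0// => [|i _]; last exact: sqr_ge0.
congr (_ ^+ 2 + _).
  by apply: eq_bigr => i _; rewrite absE !mxE rmorphB.
by rewrite absE /vert_diff2 rmorphD rmorphM rmorphB /=; field.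
Qed.

Lemma near_pairs_shell (R : realType) (n Q : nat) (c delta : R)
    (p : heis int n * heis int n) :
  (0 < Q)%N -> delta < 1 -> near_pairs c delta Q p ->
  (Q%:R - delta) ^+ 4 <=
    (\sum_i (absz ((horiz p.1 - horiz p.2)%R i ord0))%:R ^+ 2) ^+ 2
      + 4 * (absz (vert_diff2 p.1 p.2))%:R ^+ 2 <= (Q%:R + delta) ^+ 4.
Proof.
move=> Q0 d1 [_ _]; rewrite -phi4_int ler_norml => /andP[lo hi].
have Q1 : 1 <= Q%:R :> R by rewrite ler1n.
by rewrite !lerXn2r ?nnegrE ?powR_ge0//; lra.
Qed.

(** Since Q + delta <= 2 Q, each summand is at most (2 Q)^4. This confines the points to finite
    ranges. *)
Lemma shell_coord_le (R : realType) (d Q m : nat) (delta : R) (a : 'I_d -> nat) :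
  (0 < Q)%N -> 0 < delta -> delta < 1 ->
  (\sum_i (a i)%:R ^+ 2) ^+ 2 + 4 * m%:R ^+ 2 <= (Q%:R + delta) ^+ 4 ->
  (forall i, (a i <= 2 * Q)%N) /\ (m <= 2 * Q ^ 2)%N.
Proof.
move=> Q0 d0 d1 le_shell.
have Q1 : 1 <= Q%:R :> R by rewrite ler1n.
have {}le_shell : (\sum_i (a i)%:R ^+ 2) ^+ 2 + 4 * m%:R ^+ 2
    <= ((2 * Q%:R) ^+ 2) ^+ 2 :> R.
  apply: le_trans le_shell _; rewrite -exprM lerXn2r ?nnegrE//; lra.
split=> [i|].
  rewrite -(ler_nat R) natrM -(@ler_pXn2r _ 2)// ?nnegrE ?mulr_ge0//.
  rewrite -(@ler_pXn2r _ 2)// ?nnegrE ?sqr_ge0//.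
  apply: (@le_trans _ _ ((\sum_i (a i)%:R ^+ 2) ^+ 2)).
    rewrite lerXn2r// ?nnegrE ?sqr_ge0 ?sumr_ge0//.
    by rewrite (bigD1 i)//= lerDl sumr_ge0.
  by apply: le_trans le_shell; rewrite lerDl mulr_ge0 ?sqr_ge0.
rewrite -(ler_nat R) natrM natrX -(@ler_pXn2r _ 2)// ?nnegrE ?mulr_ge0 ?sqr_ge0//.
have : 0 <= (\sum_i (a i)%:R ^+ 2) ^+ 2 :> R by rewrite sqr_ge0.
move: le_shell; set x := _ ^+ 2; lra.
Qed.

(** Decoding from sign and absolute value; the bounds keep [inord] away from its default value. *)
Lemma sign_absz_inj (M : nat) (y z : int) :
  (absz y <= M)%N -> (absz z <= M)%N -> (y < 0) = (z < 0) ->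
  inord (absz y) = inord (absz z) :> 'I_M.+1 -> y = z.
Proof.
move=> yM zM sgn /(congr1 (@nat_of_ord _)); rewrite !inordK ?ltnS// => abs.
move: sgn abs; case: (ltrP y 0); case: (ltrP z 0); lia.
Qed.

Lemma trunc_lattice_absz (R : realType) (n C Q : nat) (c : R) (b : heis int n) :
  c <= C%:R -> trunc_lattice c Q b ->
  (forall i, (absz (horiz b i ord0) <= C * Q)%N) /\ (absz (vert b) <= C * Q ^ 2)%N.
Proof.
move=> cC [bh bv].
have nat_bound (z : int) (k : nat) : `|z|%:~R <= c * k%:R -> (absz z <= C * k)%N.
  move=> zk; rewrite -(ler_nat R) pmulrn abszE natrM (le_trans zk)//.
  by rewrite ler_wpM2r.
by split=> [i|]; apply: nat_bound; rewrite ?natrX.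
Qed.

(** A pair is determined by v, a and m. The prefactor counts the codes of v, of order Q^(2n+2), and
    the signs of a and m. *)
Lemma card_near_pairs (R : realType) (n C Q : nat) (c delta : R) :
  (0 < Q)%N -> c <= C%:R -> 0 < delta -> delta < 1 ->
  (#|` fset_set (@near_pairs R n c delta Q)|%fset <=
  ((2 * (C * Q).+1) ^ (n + n) * (2 * (C * Q ^ 2).+1) * (2 ^ (n + n) * 2)) *
  #|[pred p : {ffun 'I_(n + n) -> 'I_(2 * Q).+1} * 'I_(2 * Q ^ 2).+1 |
      ((Q%:R - delta) ^+ 4 <= (\sum_i (p.1 i)%:R ^+ 2) ^+ 2 + 4 * p.2%:R ^+ 2
        <= (Q%:R + delta) ^+ 4)%R]|)%N.
Proof.
move=> Q0 cC d0 d1; set shell := [pred p | _].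
(* Signs are encoded separately, so that the shell condition only involves the
   absolute values. *)
pose enc M (z : int) : bool * 'I_M.+1 := (z < 0, inord (absz z)).
pose Code := ({ffun 'I_(n + n) -> bool * 'I_(C * Q).+1} * (bool * 'I_(C * Q ^ 2).+1)
  * ({ffun 'I_(n + n) -> bool} * bool))%type.
pose f (p : heis int n * heis int n) :=
  let a := horiz p.1 - horiz p.2 in let m := vert_diff2 p.1 p.2 in
  (([ffun i : 'I_(n + n) => enc (C * Q)%N (horiz p.2 i ord0)],
    enc (C * Q ^ 2)%N (vert p.2)),
   ([ffun i : 'I_(n + n) => a i ord0 < 0], m < 0),
   ([ffun i : 'I_(n + n) => inord (absz (a i ord0)) : 'I_(2 * Q).+1],
    inord (absz m) : 'I_(2 * Q ^ 2).+1)).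
have small (p : heis int n * heis int n) : near_pairs c delta Q p ->
    (forall i, (absz ((horiz p.1 - horiz p.2)%R i ord0) <= 2 * Q)%N) /\
    (absz (vert_diff2 p.1 p.2) <= 2 * Q ^ 2)%N.
  move=> /(near_pairs_shell _ _ _ _ _ _ Q0 d1)/andP[_].
  exact: shell_coord_le.
pose D := [predX (xpredT : pred Code) & shell].
apply: leq_trans (card_fset_set_le _ _ _ f D _ _ _) _.
- exact: finite_near_pairs.
- move=> p np; have [ha hm] := small p np.
  rewrite !inE /= inordK ?ltnS//.
  under eq_bigr => i _ do rewrite ffunE inordK ?ltnS ?ha//.
  exact: near_pairs_shell np.
- move=> [u v] [u' v'] np np'.
  have [ha hm] := small _ np; have [ha' hm'] := small _ np'.
  have [vh vv] : _ /\ _ :=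
    let: And3 _ h _ := np in trunc_lattice_absz _ _ _ _ _ _ cC h.
  have [vh' vv'] : _ /\ _ :=
    let: And3 _ h _ := np' in trunc_lattice_absz _ _ _ _ _ _ cC h.
  move=> [/ffunP eh ev0 ev1 /ffunP es em0 /ffunP ea em1].
  have hv : horiz v = horiz v'.
    apply/matrixP => i j; rewrite (ord1 j); have := eh i; rewrite !ffunE.
    by case=> ? ?; apply: (sign_absz_inj (C * Q)%N).
  have vE : v = v'.
    by apply: heis_ext => //; apply: (sign_absz_inj (C * Q ^ 2)%N).
  subst v'.
  have hu : horiz u - horiz v = horiz u' - horiz v.
    apply/matrixP => i j; rewrite (ord1 j).
    have := es i; have := ea i; rewrite !ffunE => ? ?.
    exact: (sign_absz_inj (2 * Q)%N).
  have {}hu : horiz u = horiz u' by apply: (addIr (- horiz v)).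
  have : vert_diff2 u v = vert_diff2 u' v by apply: (sign_absz_inj (2 * Q ^ 2)%N).
  (* Once the horizontal parts agree, the symplectic terms cancel and the vertical parts can be
     compared. *)
  rewrite /vert_diff2 hu => /addIr uv; congr pair; apply: heis_ext => //.
by move: uv => /(mulfI (_ : 2 != 0 :> int)) => /(_ isT) /addIr.
by rewrite cardX !card_prod !card_ffun !card_prod !card_bool !card_ord.
Qed.

(** * Assembly of the constant *)

Theorem theorem1p1 (R : realType) (n : nat) (hn : (1 <= n)%N)
    (c : R) (hc : 0 < c) :
  exists K : R, 0 < K /\
    forall (delta : R) (Q : nat),
      0 < delta -> delta < 1 -> (1 <= Q)%N ->
      Q%:R ^- (2 * n + 2) * (#|` fset_set (@near_pairs R n c delta Q)|%fset)%:R
        <= K * Num.max (Q%:R ^+ (2 * n)) (Q%:R ^+ (2 * n + 1) * delta).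
Proof.
pose C := (Num.truncn c).+1.
have cC : c <= C%:R by rewrite ltW// truncnS_gt.
have -> : (2 * n = n + n)%N by rewrite mul2n addnn.
set d := (n + n)%N.
pose W : R := ((4 * C) ^ d * (4 * C) * (2 ^ d * 2))%N%:R.
pose K0 : R := 32 + d%:R * (5 + 64 * d.+1%:R ^+ 3).
have W0 : 0 < W by rewrite ltr0n !muln_gt0 !expn_gt0.
have K00 : 0 < K0 by rewrite ltr_wpDr// mulr_ge0// addr_ge0// mulr_ge0.
exists (W * (K0 * 3 ^+ d * 2)); split; first by rewrite !mulr_gt0 ?exprn_gt0.
move=> delta Q d0 d1 Q1; have q0 : 0 < Q%:R :> R by rewrite ltr0n.
set mx := Num.max _ _.
(* As C Q >= 1, the added units are absorbed: 2 (C Q + 1) <= 4 C Q, and likewise with Q^2. *)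
have codes : ((2 * (C * Q).+1) ^ d * (2 * (C * Q ^ 2).+1) * (2 ^ d * 2))%N%:R
    <= W * Q%:R ^+ (d + 2).
  have -> : W * Q%:R ^+ (d + 2) =
      ((4 * C * Q) ^ d * (4 * C * Q ^ 2) * (2 ^ d * 2))%N%:R.
    by rewrite /W -natrX -natrM; congr (_%:R); rewrite (expnMn (4 * C)) expnD; ring.
  rewrite ler_nat leq_mul// leq_mul//; last by rewrite /C; nia.
  by rewrite leq_exp2r ?addn_gt0 ?hn// /C; nia.
have mxE : (1 + Q%:R * delta) * Q%:R ^+ d <= 2 * mx.
  have : Q%:R ^+ d <= mx by rewrite le_max lexx.
  have : Q%:R ^+ (d + 1) * delta <= mx by rewrite le_max lexx orbT.
  rewrite -/mx addn1 exprS; lra.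
have shell := koranyi_shell_count R d Q (2 * Q ^ 2).+1 delta Q1 d0 d1.
rewrite ler_pdivrMl ?exprn_gt0//.
have := card_near_pairs R n C Q c delta Q1 cC d0 d1.
rewrite -(ler_nat R) natrM => /le_trans; apply.
apply: le_trans (ler_pM _ _ codes shell) _ => //.
(* 2 Q + 1 <= 3 Q is the source of the factor 3^d. *)
have N3 : (2 * Q).+1%:R ^+ d <= (3 * Q%:R) ^+ d :> R.
  by rewrite lerXn2r ?nnegrE ?mulr_ge0// -natrM ler_nat; lia.
have qd0 : 0 <= 1 + Q%:R * delta by rewrite addr_ge0// mulr_ge0 ?ltW.
have key : (1 + Q%:R * delta) * (2 * Q).+1%:R ^+ d <= 3 ^+ d * (2 * mx).
  apply: le_trans (ler_wpM2l qd0 N3) _.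
  by rewrite exprMn mulrCA ler_pM2l ?exprn_gt0.
rewrite -/K0.
have -> : Q%:R ^+ (d + 2) * (W * (K0 * 3 ^+ d * 2) * mx) =
    W * Q%:R ^+ (d + 2) * (K0 * (3 ^+ d * (2 * mx))) by ring.
by rewrite -(mulrA K0) ler_pM2l ?ler_pM2l// mulr_gt0 ?exprn_gt0.
Qed.
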